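(* Let $\mathcal{P}$ be any non-empty set of prime numbers. For any $\boldsymbol{\alpha}\in X_{\mathcal{P}}$ and any $N\in\mathbb{N}$, we have $g_N(\boldsymbol{\alpha})\le 3$. Furthermore, (for every such $\mathcal{P}$) there exist $\boldsymbol{\alpha}\in X_{\mathcal{P}}$ and $N\in\mathbb{N}$ for which $g_N(\boldsymbol{\alpha})=3$.
   Context: $\mathbb{N}=\{1,2,3,\ldots\}$. For a prime $p$, $|\cdot|_p$ is the usual $p$-adic absolute value on $\mathbb{Q}_p$ (so $|p|_p=1/p$), $\mathbb{Z}_p=\{x\in\mathbb{Q}_p:|x|_p\le 1\}$, and $|\cdot|_\infty$ is the usual absolute value on $\mathbb{R}$. Let $\mathcal{P}$ be a non-empty (finite or infinite) set of primes. $\mathbb{A}_{\mathcal{P}}$ is the projection of the ring of rational adeles to the places $\{\infty\}\cup\mathcal{P}$: the ring (with coordinatewise operations) of all $\boldsymbol{\alpha}=(\alpha_\infty,(\alpha_p)_{p\in\mathcal{P}})\in\mathbb{R}\times\prod_{p\in\mathcal{P}}\mathbb{Q}_p$ with $\alpha_p\in\mathbb{Z}_p$ for all but finitely many $p\in\mathcal{P}$, with the restricted product topology. Let $\Gamma_{\mathcal{P}}=\mathbb{Z}[1/p:p\in\mathcal{P}]\subset\mathbb{Q}$, identified with its image in $\mathbb{A}_{\mathcal{P}}$ under the diagonal embedding $\gamma\mapsto\boldsymbol{\gamma}=(\gamma,\gamma,\ldots)$. Let $X_{\mathcal{P}}=\mathbb{A}_{\mathcal{P}}/\Gamma_{\mathcal{P}}$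 (quotient of additive groups). For $\boldsymbol{\alpha},\boldsymbol{\beta}\in\mathbb{A}_{\mathcal{P}}$ put $$|\boldsymbol{\alpha}-\boldsymbol{\beta}|=\begin{cases}\max\{|\alpha_\infty-\beta_\infty|_\infty,\ \max_{p\in\mathcal{P}}|\alpha_p-\beta_p|_p\}&\text{if }|\mathcal{P}|<\infty,\\ \max\{|\alpha_\infty-\beta_\infty|_\infty,\ \max_{p\in\mathcal{P}}|\alpha_p-\beta_p|_p/p\}&\text{if }|\mathcal{P}|=\infty,\end{cases}$$ and define a metric on $X_{\mathcal{P}}$ by $\|\boldsymbol{\alpha}-\boldsymbol{\beta}\|=\min\{|\boldsymbol{\alpha}-\boldsymbol{\beta}-\boldsymbol{\gamma}|:\gamma\in\Gamma_{\mathcal{P}}\}$. For $\boldsymbol{\alpha}\in\mathbb{A}_{\mathcal{P}}$ (everything below depends only on its class in $X_{\mathcal{P}}$) and $N\in\mathbb{N}$, let $\boldsymbol{\xi}_n=n\boldsymbol{\alpha}+\Gamma_{\mathcal{P}}\in X_{\mathcal{P}}$ for $1\le n\le N$, let $$\delta_{n,N}(\boldsymbol{\alpha})=\min\{\|\boldsymbol{\xi}_m-\boldsymbol{\xi}_n\|>0:1\le m\le N\}$$ (the minimum of those distances that are strictly positive), and let $g_N(\boldsymbol{\alpha})=|\{\delta_{n,N}(\boldsymbol{\alpha}):1\le n\le N\}|$ be the number of distinct values. Convention: if the points $\boldsymbol{\xi}_1,\ldots,\boldsymbol{\xi}_N$ all coincide (for instance if $N=1$), the set of positive distances is empty for every $n$,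 and one sets $\delta_{n,N}(\boldsymbol{\alpha})=+\infty$ for every $n$, so that $g_N(\boldsymbol{\alpha})=1$. *)

(* Defs.v *)
From HB Require Import structures.
From mathcomp Require Import all_boot all_order all_algebra.
From mathcomp Require Import ring_quotient.
From mathcomp Require Import mathcomp_extra boolp classical_sets functions.
From mathcomp Require Import cardinality reals ereal topology normedtype sequences.
From mathcomp Require Import zify ring lra.

Set Implicit Arguments.
Unset Strict Implicit.
Unset Printing Implicit Defensive.

Import Order.TTheory GRing.Theory Num.Theory.
Import numFieldNormedType.Exports.

Local Open Scope classical_set_scope.
Local Open Scope ring_scope.
Local Open Scope quotient_scope.

(* |x|_p for x in Q, as a rational number.  When p is not prime, logn p is    *)
(* identically 0, so that this is the trivial absolute value (and Qp p below  *)
(* is just Q): primality of p is not needed for the constructions.            *)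
Definition rat_abs (p : nat) (x : rat) : rat :=
  if x == 0 then 0
  else p%:R ^ ((logn p `|denq x|%N)%:Z - (logn p `|numq x|%N)%:Z).

Section RatAbs.
Variable p : nat.
Local Notation v m := (logn p (absz (m)%R))%:Z.

Lemma rat_abs0 : rat_abs p 0 = 0. Proof. by rewrite /rat_abs eqxx. Qed.

Lemma logn_nonprime (m : nat) : ~~ prime p -> logn p m = 0%N.
Proof. by move=> np; rewrite lognE (negbTE np). Qed.

Lemma rat_abs_frac (a b : int) : a != 0 -> b != 0 ->
  rat_abs p (a%:~R / b%:~R) = p%:R ^ (v b - v a).
Proof.
move=> a0 b0; rewrite /rat_abs mulf_eq0 invr_eq0 !intr_eq0 (negbTE a0).
rewrite (negbTE b0) /=; set x := _ / _.
have x0 : x != 0 by rewrite /x mulf_neq0 ?invr_eq0 ?intr_eq0.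
congr (_ ^ _).
have E : numq x * b = a * denq x.
  apply/(@intr_inj rat); rewrite !rmorphM /= numqE.
  by rewrite {1}/x mulrAC mulrVK // unitfE intr_eq0.
have : v (numq x * b) = v (a * denq x) by rewrite E.
rewrite !abszM !lognM ?absz_gt0 ?numq_eq0 ?denq_eq0 // !PoszD.
move: (v _) (v _) (v _) (v _) => i j k l.
by clear; lia.
Qed.

Lemma rat_abs_gt0 x : x != 0 -> 0 < rat_abs p x.
Proof.
move=> x0; rewrite /rat_abs (negbTE x0).
have [pp|np] := boolP (prime p); first by rewrite exprz_gt0// ltr0n prime_gt0.
by rewrite !logn_nonprime// subrr expr0z.
Qed.

Lemma rat_abs_ge0 x : 0 <= rat_abs p x.
Proof.
by have [->|/rat_abs_gt0/ltW//] := eqVneq x 0; rewrite rat_abs0.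
Qed.

Lemma rat_abs1 : rat_abs p 1 = 1.
Proof. by rewrite -[X in rat_abs p X]divr1 -[1]/(1%:~R) rat_abs_frac// subrr. Qed.

Lemma rat_absN x : rat_abs p (- x) = rat_abs p x.
Proof. by rewrite /rat_abs oppr_eq0 numqN denqN abszN. Qed.

Lemma rat_absM x y : rat_abs p (x * y) = rat_abs p x * rat_abs p y.
Proof.
have [->|x0] := eqVneq x 0; first by rewrite mul0r rat_abs0 mul0r.
have [->|y0] := eqVneq y 0; first by rewrite mulr0 rat_abs0 mulr0.
have [pp|np] := boolP (prime p); last first.
  rewrite /rat_abs mulf_eq0 (negbTE x0) (negbTE y0) /=.
  by rewrite !logn_nonprime// subrr expr0z mulr1.
have p0 : p%:R != 0 :> rat by rewrite pnatr_eq0 -lt0n prime_gt0.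
rewrite -{1}[x]divq_num_den -{1}[y]divq_num_den mulf_div -!rmorphM /=.
rewrite rat_abs_frac ?mulf_neq0 ?numq_eq0 ?denq_eq0//.
rewrite /rat_abs (negbTE x0) (negbTE y0) -expfzDr//; congr (_ ^ _).
rewrite !abszM !lognM ?absz_gt0 ?numq_eq0 ?denq_eq0 // !PoszD.
move: (v _) (v _) (v _) (v _) => i j k l.
by clear; lia.
Qed.

Lemma rat_absD x y : rat_abs p (x + y) <= Num.max (rat_abs p x) (rat_abs p y).
Proof.
have [->|x0] := eqVneq x 0.
  by rewrite add0r le_max lexx orbT.
have [->|y0] := eqVneq y 0; first by rewrite addr0 le_max lexx.
have [->|xy0] := eqVneq (x + y) 0; first by rewrite rat_abs0 le_max rat_abs_ge0.
have [pp|np] := boolP (prime p); last first.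
  rewrite /rat_abs (negbTE x0) (negbTE y0) (negbTE xy0) /=.
  by rewrite !logn_nonprime// subrr expr0z maxxx.
have p1 : 1 <= p%:R :> rat by rewrite ler1n prime_gt0.
have d0 z : (denq z)%:~R != 0 :> rat by rewrite intr_eq0 denq_eq0.
pose a := numq x * denq y; pose b := numq y * denq x.
pose d := denq x * denq y.
have dn0 : d != 0 by rewrite mulf_neq0 ?denq_eq0.
have xE : x = a%:~R / d%:~R.
  by rewrite !rmorphM /= -mulf_div divq_num_den divff// mulr1.
have yE : y = b%:~R / d%:~R.
  by rewrite !rmorphM /= [_ * (denq y)%:~R]mulrC -mulf_div divq_num_den divff// mulr1.
have xyE : x + y = (a + b)%:~R / d%:~R by rewrite rmorphD /= mulrDl -xE -yE.
have a0 : a != 0 by rewrite mulf_neq0 ?numq_eq0 ?denq_eq0.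
have b0 : b != 0 by rewrite mulf_neq0 ?numq_eq0 ?denq_eq0.
have ab0 : a + b != 0.
  by apply: contraNneq xy0 => ab; rewrite xyE ab mul0r.
rewrite xyE xE yE !rat_abs_frac// le_max.
have dvd k : (p ^ k %| absz a)%N -> (p ^ k %| absz b)%N ->
    (k <= logn p (absz (a + b)%R))%N.
  move=> ka kb; rewrite -pfactor_dvdn ?absz_gt0//.
  by have: ((p ^ k)%N%:Z %| a + b)%Z by apply: rpredD.
have [le|lt] := leqP (logn p (absz a)) (logn p (absz b)).
  apply/orP; left; apply: ler_weXz2l => //; rewrite lerD2l lerN2 lez_nat.
  by apply: dvd; rewrite pfactor_dvdn ?absz_gt0.
apply/orP; right; apply: ler_weXz2l => //; rewrite lerD2l lerN2 lez_nat.
by apply: dvd; rewrite pfactor_dvdn ?absz_gt0// ltnW.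
Qed.

Lemma rat_absB x y : rat_abs p (x - y) <= Num.max (rat_abs p x) (rat_abs p y).
Proof. by rewrite -(rat_absN y); apply: rat_absD. Qed.

Lemma rat_absBC x y : rat_abs p (x - y) = rat_abs p (y - x).
Proof. by rewrite -opprB rat_absN. Qed.

Lemma rat_abs_stable x y :
  rat_abs p (x - y) < rat_abs p x -> rat_abs p y = rat_abs p x.
Proof.
move=> xy; apply/le_anti/andP; split.
  have := rat_absB x (x - y); rewrite subKr => /le_trans; apply.
  by rewrite ge_max lexx ltW.
have := rat_absD (x - y) y; rewrite subrK => /le_trans; apply.
rewrite ge_max lexx andbT leNgt; apply/negP => yx.
have := rat_absD (x - y) y; rewrite subrK le_max.
by rewrite leNgt xy /= leNgt (lt_trans yx xy).
Qed.

End RatAbs.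

Section CauchySeq.
Variable p : nat.
Implicit Types u v : nat -> rat.

Definition cauchy_seq u : Prop := forall e : rat, 0 < e ->
  exists n0, forall m n, (n0 <= m)%N -> (n0 <= n)%N ->
    rat_abs p (u m - u n) < e.

Definition null_seq u : Prop := forall e : rat, 0 < e ->
  exists n0, forall n, (n0 <= n)%N -> rat_abs p (u n) < e.

Lemma cauchy_seq_cases u : cauchy_seq u ->
  null_seq u \/
  exists2 c, 0 < c & exists n0, forall n, (n0 <= n)%N -> rat_abs p (u n) = c.
Proof.
move=> uc; have [|nn] := pselect (null_seq u); first by left.
right; have [e e0 ne] : exists2 e, 0 < e &
    forall n0, exists2 n, (n0 <= n)%N & e <= rat_abs p (u n).
  apply: contra_notP nn => /forall2NP H e e0.
  have [/(_ e0)//|/existsNP[n0 Hn]] := H e.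
  exists n0 => n n0n; rewrite ltNge; apply/negP => en.
  by apply: Hn; exists n.
have [n0 un0] := uc _ e0; have [n1 n01 en1] := ne n0.
exists (rat_abs p (u n1)); first exact: lt_le_trans en1.
exists n1 => n n1n; apply: rat_abs_stable.
by apply: lt_le_trans en1; apply: un0 => //; exact: leq_trans n1n.
Qed.

Lemma cauchy_seq_bounded u : cauchy_seq u ->
  exists2 B, 0 < B & exists n0, forall n, (n0 <= n)%N -> rat_abs p (u n) <= B.
Proof.
move=> /cauchy_seq_cases[/(_ 1 ltr01)[n0 un0]|[c c0 [n0 un0]]].
  by exists 1 => //; exists n0 => n /un0/ltW.
by exists c => //; exists n0 => n /un0 ->.
Qed.

Definition cauchy_pred : {pred nat -> rat} := [pred u | `[< cauchy_seq u >]].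

Lemma cauchy_seq_subring : subring_closed cauchy_pred.
Proof.
split=> [|u v /asboolP uc /asboolP vc|u v /asboolP uc /asboolP vc]; apply/asboolP.
- by move=> e e0; exists 0%N => m n _ _; rewrite subrr rat_abs0.
- move=> e e0; have [i ui] := uc _ e0; have [j vj] := vc _ e0.
  exists (maxn i j) => m n; rewrite !geq_max => /andP[im jm] /andP[in_ jn].
  have -> : (u - v) m - (u - v) n = (u m - u n) - (v m - v n).
    by rewrite !fctE; ring.
  by apply: (le_lt_trans (rat_absB _ _ _)); rewrite gt_max ui ?vj.
- move=> e e0.
  have [B B0 [i0 uB]] := cauchy_seq_bounded uc.
  have [C C0 [j0 vC]] := cauchy_seq_bounded vc.
  have [i ui] := uc _ (divr_gt0 e0 C0); have [j vj] := vc _ (divr_gt0 e0 B0).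
  exists (maxn (maxn i0 i) (maxn j0 j)) => m n.
  rewrite !geq_max => /andP[/andP[i0m im] /andP[j0m jm]].
  move=> /andP[/andP[i0n in_] /andP[j0n jn]].
  have -> : (u * v) m - (u * v) n = u m * (v m - v n) + (u m - u n) * v n.
    by rewrite !fctE; ring.
  apply: (le_lt_trans (rat_absD _ _ _)); rewrite gt_max !rat_absM.
  apply/andP; split.
    apply: (@le_lt_trans _ _ (B * rat_abs p (v m - v n))).
      by apply: ler_wpM2r; rewrite ?rat_abs_ge0 ?uB.
    by rewrite mulrC -ltr_pdivlMr// vj.
  apply: (@le_lt_trans _ _ (rat_abs p (u m - u n) * C)).
    by apply: ler_wpM2l; rewrite ?rat_abs_ge0 ?vC.
  by rewrite -ltr_pdivlMr// ui.
Qed.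

HB.instance Definition _ :=
  GRing.isSubringClosed.Build (nat -> rat) cauchy_pred cauchy_seq_subring.

Record cauchyRat := CauchyRat { cseq :> nat -> rat; _ : cseq \in cauchy_pred }.

HB.instance Definition _ := [isSub for cseq].
HB.instance Definition _ := [Choice of cauchyRat by <:].
HB.instance Definition _ := [SubChoice_isSubComNzRing of cauchyRat by <:].

Lemma cauchyRatP (u : cauchyRat) : cauchy_seq u.
Proof. by case: u => u /= /asboolP. Qed.

Definition null_pred : {pred cauchyRat} := [pred u | `[< null_seq (cseq u) >]].

Lemma null_pred_ideal : idealr_closed null_pred.
Proof.
split.
- by apply/asboolP => e e0; exists 0%N => n _; rewrite rat_abs0.
- apply/asboolP => /(_ 1 ltr01)[n0 /(_ _ (leqnn _))].
  by rewrite rat_abs1 ltxx.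
- move=> a u v /asboolP un /asboolP vn; apply/asboolP => e e0.
  have [B B0 [i0 aB]] := cauchy_seq_bounded (cauchyRatP a).
  have [i ui] := un _ (divr_gt0 e0 B0); have [j vj] := vn _ e0.
  exists (maxn i0 (maxn i j)) => n; rewrite !geq_max => /and3P[i0n in_ jn].
  apply: (le_lt_trans (rat_absD _ _ _)); rewrite gt_max vj// andbT rat_absM.
  apply: (@le_lt_trans _ _ (B * rat_abs p (u n))).
    by apply: ler_wpM2r; rewrite ?rat_abs_ge0 ?aB.
  by rewrite mulrC -ltr_pdivlMr// ui.
Qed.

HB.instance Definition _ := isIdealr.Build cauchyRat null_pred null_pred_ideal.

(* Q_p: the completion of Q for |.|_p, i.e. the ring of p-adic Cauchy         *)
(* sequences of rationals modulo the ideal of null sequences.                 *)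
Definition Qp := {ideal_quot null_pred}.

HB.instance Definition _ := GRing.ComNzRing.on Qp.
HB.instance Definition _ := EqQuotient.on Qp.

Lemma Qp_eqP (u v : cauchyRat) :
  \pi_Qp u = \pi_Qp v <-> null_seq (cseq (u - v)).
Proof.
split=> [/eqP|n]; first by rewrite -Quotient.idealrBE => /asboolP.
by apply/eqP; rewrite -Quotient.idealrBE; apply/asboolP.
Qed.

Lemma Qp_neq0_inv (x : Qp) : x != 0 -> exists y, y * x = 1.
Proof.
rewrite -[x]reprK; set u := repr x => x0.
have [un|[c c0 [n0 uc]]] := cauchy_seq_cases (cauchyRatP u).
  case/eqP: x0; rewrite -(rmorph0 \pi_Qp); apply/Qp_eqP.
  by rewrite subr0.
have u0 n : (n0 <= n)%N -> u n != 0.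
  by move=> /uc un; apply: contraTneq c0 => e; rewrite -un e rat_abs0 ltxx.
have wc : (fun n => (u n)^-1) \in cauchy_pred.
  apply/asboolP => e e0.
  have [i ui] := cauchyRatP u (mulr_gt0 e0 (mulr_gt0 c0 c0)).
  exists (maxn n0 i) => m n; rewrite !geq_max => /andP[m0 im] /andP[n0' in_].
  have -> : (u m)^-1 - (u n)^-1 = (u n - u m) / (u m * u n).
    by field; rewrite !u0.
  have uv0 : u m * u n != 0 by rewrite mulf_neq0 ?u0.
  rewrite -(ltr_pM2r (rat_abs_gt0 p uv0)) -rat_absM divfK// rat_absM !uc//.
  exact: ui.
exists (\pi_Qp (CauchyRat wc)); rewrite -rmorphM -(rmorph1 \pi_Qp).
apply/Qp_eqP => e e0; exists n0 => n n0n /=.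
by rewrite !fctE /= mulVf ?u0// subrr rat_abs0.
Qed.

Definition Qp_inv (x : Qp) : Qp := xget 0 [set y | y * x = 1].

Lemma Qp_mulVf (x : Qp) : x != 0 -> Qp_inv x * x = 1.
Proof. by move=> /Qp_neq0_inv[y yx]; rewrite /Qp_inv; case: xgetP => //= /(_ y). Qed.

Lemma Qp_inv0 : Qp_inv 0 = 0.
Proof.
rewrite /Qp_inv xgetPN// => y /= /esym/eqP.
by rewrite mulr0 oner_eq0.
Qed.

HB.instance Definition _ := GRing.ComNzRing_isField.Build Qp Qp_mulVf Qp_inv0.

Lemma cst_cauchy (x : rat) : (fun=> x) \in cauchy_pred.
Proof.
by apply/asboolP => e e0; exists 0%N => m n _ _; rewrite subrr rat_abs0.
Qed.

Definition Qp_of_rat (x : rat) : Qp := \pi_Qp (CauchyRat (cst_cauchy x)).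

Lemma Qp_of_rat_zmod_morphism : zmod_morphism Qp_of_rat.
Proof.
by move=> x y; rewrite /Qp_of_rat -rmorphB; congr (\pi_Qp _); apply/val_inj.
Qed.

Lemma Qp_of_rat_monoid_morphism : monoid_morphism Qp_of_rat.
Proof.
split=> [|x y]; first by rewrite -(rmorph1 \pi_Qp); congr (\pi_Qp _); apply/val_inj.
by rewrite /Qp_of_rat -rmorphM; congr (\pi_Qp _); apply/val_inj.
Qed.

HB.instance Definition _ :=
  GRing.isZmodMorphism.Build rat Qp Qp_of_rat Qp_of_rat_zmod_morphism.
HB.instance Definition _ :=
  GRing.isMonoidMorphism.Build rat Qp Qp_of_rat Qp_of_rat_monoid_morphism.

End CauchySeq.

(* |x|_p for x in Q_p, as a real number; repr x is a Cauchy sequence of       *)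
(* rationals representing x.                                                  *)
Definition Qp_abs (R : realType) (p : nat) (x : Qp p) : R :=
  limn (fun n => ratr (rat_abs p (repr x n)) : R).

Section QpAbs.
Variables (R : realType) (p : nat).

Lemma null_seq_cvg (u : nat -> rat) : null_seq p u ->
  (fun n => ratr (rat_abs p (u n)) : R) @ \oo --> (0 : R).
Proof.
move=> un; apply/cvgrPdist_lt => e e0.
have [q /andP[q0 qe]] : exists q : rat, (0 < (ratr q : R)) && ((ratr q : R) < e).
  have [q] := @rat_in_itvoo R 0 e e0.
  by rewrite in_itv /= => h; exists q.
move: q0; rewrite ltr0q => /un[n0 H].
exists n0 => // n /= n0n; rewrite sub0r normrN ger0_norm ?ler0q ?rat_abs_ge0//.
by apply: lt_trans qe; rewrite ltr_rat H.
Qed.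

Lemma cst_seq_cvg (u : nat -> rat) c n0 :
  (forall n, (n0 <= n)%N -> rat_abs p (u n) = c) ->
  (fun n => ratr (rat_abs p (u n)) : R) @ \oo --> (ratr c : R).
Proof. by move=> H; apply: cvg_near_cst; exists n0 => // n /= /H ->. Qed.

Lemma Qp_abs_cvg (u : cauchyRat p) :
  (fun n => ratr (rat_abs p (u n)) : R) @ \oo --> Qp_abs R (\pi_(Qp p) u).
Proof.
have := cauchyRatP u; rewrite /Qp_abs; set w := repr _.
have uw : null_seq p (cseq (u - w)) by apply/Qp_eqP; rewrite /w reprK.
move=> /cauchy_seq_cases[un|[c c0 [n0 uc]]].
  have wn : null_seq p w.
    move=> e e0; have [i ui] := un _ e0; have [j uwj] := uw _ e0.
    exists (maxn i j) => n; rewrite geq_max => /andP[/ui ni /uwj nj].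
    have -> : w n = u n - (u - w) n by rewrite /= !fctE opprB addrC subrK.
    by apply: (le_lt_trans (rat_absB _ _ _)); rewrite gt_max ni.
  by rewrite (cvg_lim _ (null_seq_cvg wn))//; exact: null_seq_cvg.
have [j uwj] := uw _ c0.
have wc n : (maxn n0 j <= n)%N -> rat_abs p (w n) = c.
  rewrite geq_max => /andP[/uc unc /uwj nj].
  by rewrite -unc; apply: rat_abs_stable; rewrite unc.
by rewrite (cvg_lim _ (cst_seq_cvg wc))//; exact: cst_seq_cvg uc.
Qed.

Lemma Qp_abs_rat (x : rat) : Qp_abs R (Qp_of_rat p x) = ratr (rat_abs p x).
Proof.
have h := @Qp_abs_cvg (CauchyRat (cst_cauchy p x)).
have h2 := @cst_seq_cvg (fun=> x) (rat_abs p x) 0 (fun _ _ => erefl).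
by apply: (cvg_unique _ h h2); exact: norm_hausdorff.
Qed.

(* Z_p *)
Definition Qp_int : set (Qp p) := [set x | Qp_abs R x <= 1].

Lemma Qp_intP (u : cauchyRat p) : Qp_int (\pi_(Qp p) u) <->
  exists n0, forall n, (n0 <= n)%N -> rat_abs p (u n) <= 1.
Proof.
have ucvg := @Qp_abs_cvg u; split=> [x1|[n0 un]]; last first.
  rewrite /Qp_int /= -(cvg_lim _ ucvg)//; apply: limr_le; first exact: cvgP ucvg.
  by exists n0 => // n /= /un; rewrite -(ler_rat R) rmorph1.
have [/(_ 1 ltr01)[n0 un]|[c c0 [n0 uc]]] := cauchy_seq_cases (cauchyRatP u).
  by exists n0 => n /un/ltW.
exists n0 => n /uc ->; rewrite -(ler_rat R) rmorph1.
by rewrite -(cvg_lim _ (cst_seq_cvg uc))// (cvg_lim _ ucvg).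
Qed.

Lemma Qp_int1 : Qp_int 1.
Proof.
rewrite -(rmorph1 \pi_(Qp p)); apply/Qp_intP; exists 0%N => n _.
by rewrite rat_abs1.
Qed.

Lemma Qp_intB x y : Qp_int x -> Qp_int y -> Qp_int (x - y).
Proof.
rewrite -[x]reprK -[y]reprK -rmorphB => /Qp_intP[i xi] /Qp_intP[j yj].
apply/Qp_intP; exists (maxn i j) => n; rewrite geq_max => /andP[/xi ni /yj nj].
by apply: (le_trans (rat_absB _ _ _)); rewrite ge_max ni.
Qed.

Lemma Qp_intM x y : Qp_int x -> Qp_int y -> Qp_int (x * y).
Proof.
rewrite -[x]reprK -[y]reprK -rmorphM => /Qp_intP[i xi] /Qp_intP[j yj].
apply/Qp_intP; exists (maxn i j) => n; rewrite geq_max => /andP[/xi ni /yj nj].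
by rewrite /= fctE rat_absM mulr_ile1 ?rat_abs_ge0.
Qed.

End QpAbs.

Definition Qprod (P : set nat) := forall q : P, Qp (val q).

Section Qprod.
Variable P : set nat.
Implicit Types x y z : Qprod P.

HB.instance Definition _ := Choice.on (Qprod P).

Definition Qprod0 : Qprod P := fun=> 0.
Definition Qprod1 : Qprod P := fun=> 1.
Definition Qprod_opp x : Qprod P := fun q => - x q.
Definition Qprod_add x y : Qprod P := fun q => x q + y q.
Definition Qprod_mul x y : Qprod P := fun q => x q * y q.

Lemma Qprod_addA : associative Qprod_add.
Proof. by move=> x y z; apply: functional_extensionality_dep => q; exact: addrA. Qed.
Lemma Qprod_addC : commutative Qprod_add.
Proof. by move=> x y; apply: functional_extensionality_dep => q; exact: addrC. Qed.
Lemma Qprod_add0 : left_id Qprod0 Qprod_add.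
Proof. by move=> x; apply: functional_extensionality_dep => q; exact: add0r. Qed.
Lemma Qprod_addN : left_inverse Qprod0 Qprod_opp Qprod_add.
Proof. by move=> x; apply: functional_extensionality_dep => q; exact: addNr. Qed.
Lemma Qprod_mulA : associative Qprod_mul.
Proof. by move=> x y z; apply: functional_extensionality_dep => q; exact: mulrA. Qed.
Lemma Qprod_mulC : commutative Qprod_mul.
Proof. by move=> x y; apply: functional_extensionality_dep => q; exact: mulrC. Qed.
Lemma Qprod_mul1 : left_id Qprod1 Qprod_mul.
Proof. by move=> x; apply: functional_extensionality_dep => q; exact: mul1r. Qed.
Lemma Qprod_mulD : left_distributive Qprod_mul Qprod_add.
Proof. by move=> x y z; apply: functional_extensionality_dep => q; exact: mulrDl. Qed.

HB.instance Definition _ := GRing.isZmodule.Build (Qprod P)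
  Qprod_addA Qprod_addC Qprod_add0 Qprod_addN.
Lemma Qprod_mul0 : left_zero (0 : Qprod P) Qprod_mul.
Proof. by move=> x; apply: functional_extensionality_dep => q; exact: mul0r. Qed.
HB.instance Definition _ := GRing.Zmodule_isComPzRing.Build (Qprod P)
  Qprod_mulA Qprod_mulC Qprod_mul1 Qprod_mulD.

End Qprod.

Section Adele.
Variables (R : realType) (P : set nat).

Definition adele_pred : {pred R * Qprod P} :=
  [pred a | `[< finite_set [set q : P | ~ Qp_int R (a.2 q)] >]].

Lemma adele_subring : subring_closed adele_pred.
Proof.
split=> [|a b /asboolP fa /asboolP fb|a b /asboolP fa /asboolP fb]; apply/asboolP.
- by rewrite (_ : [set _ | _] = set0)// -subset0 => q /=; apply; exact: Qp_int1.
- apply: (@sub_finite_set _ _ (_ `|` _)); last by rewrite finite_setU; split; [exact: fa|exact: fb].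
  by move=> q /= nab; apply: contrapT => /not_orP[/contrapT ia /contrapT ib];
    apply: nab; exact: Qp_intB.
- apply: (@sub_finite_set _ _ (_ `|` _)); last by rewrite finite_setU; split; [exact: fa|exact: fb].
  by move=> q /= nab; apply: contrapT => /not_orP[/contrapT ia /contrapT ib];
    apply: nab; exact: Qp_intM.
Qed.

HB.instance Definition _ :=
  GRing.isSubringClosed.Build (R * Qprod P)%type adele_pred adele_subring.

(* A_P: the restricted product of R and of the Q_p, p in P. *)
Record adele := Adele { adele_val : R * Qprod P; _ : adele_val \in adele_pred }.

HB.instance Definition _ := [isSub for adele_val].
HB.instance Definition _ := [Choice of adele by <:].
HB.instance Definition _ := GRing.SubChoice_isSubComPzRing.Build
  (R * Qprod P)%type adele_pred adele adele_subring.

Definition adele_inf (a : adele) : R := (adele_val a).1.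
Definition adele_fin (a : adele) (q : P) : Qp (val q) := (adele_val a).2 q.

Lemma diag_subproof (g : rat) :
  (ratr g, fun q => Qp_of_rat (val q) g) \in adele_pred.
Proof.
apply/asboolP; pose D : set nat := [set` primes `|denq g|].
apply: (@sub_finite_set _ _ ((fun q : P => val q) @^-1` D)); last first.
  apply: finite_preimage; last exact: finite_seq.
  by move=> q1 q2 _ _; exact: val_inj.
move=> q /= ng; rewrite /D /mkset /= -logn_gt0 lt0n; apply: contra_notN ng => /eqP d0.
rewrite /Qp_int /= Qp_abs_rat -(rmorph1 (@ratr R)) ler_rat /rat_abs d0.
case: ifP => // _; set p := val q.
have [pp|np] := boolP (prime p); last by rewrite logn_nonprime// subrr expr0z.
rewrite sub0r -invr_expz invf_le1 ?exprz_gt0 ?ltr0n ?prime_gt0//.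
by rewrite exprn_ege1// ler1n prime_gt0.
Qed.

Definition diag (g : rat) : adele := Adele (diag_subproof g).

Lemma diagB x y : diag (x - y) = diag x - diag y.
Proof.
apply/val_inj; congr pair; first exact: rmorphB.
by apply: functional_extensionality_dep => q; exact: rmorphB.
Qed.

(* Gamma_P = Z[1/p : p in P] *)
Definition Gamma : set rat :=
  smallest (fun S : set rat => subring_closed (mem S))
           [set p%:R^-1 | p in P].

Lemma GammaB x y : Gamma x -> Gamma y -> Gamma (x - y).
Proof.
move=> gx gy S [Ss PS].
have /mem_set xS := gx _ (conj Ss PS); have /mem_set yS := gy _ (conj Ss PS).
by apply/set_mem; case: Ss => _ + _; apply.
Qed.

Lemma Gamma0 : Gamma 0.
Proof.
move=> S [Ss PS]; apply/set_mem; case: Ss => S1 SB _.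
by rewrite -(subrr 1); apply: SB.
Qed.

Definition Gamma_pred : {pred adele} :=
  [pred a | `[< exists2 g, Gamma g & a = diag g >]].

Lemma Gamma_pred_zmod : zmod_closed Gamma_pred.
Proof.
split=> [|_ _ /asboolP[x gx ->] /asboolP[y gy ->]]; apply/asboolP.
  exists 0; first exact: Gamma0.
  by rewrite -(subrr (0 : rat)) diagB subrr.
by exists (x - y); [exact: GammaB|rewrite diagB].
Qed.

HB.instance Definition _ :=
  GRing.isZmodClosed.Build adele Gamma_pred Gamma_pred_zmod.

(* X_P = A_P / Gamma_P *)
Definition solenoid := {ideal_quot Gamma_pred}.

HB.instance Definition _ := GRing.Zmodule.on solenoid.
HB.instance Definition _ := EqQuotient.on solenoid.

(* Both suprema are maxima: in the first one the index set is finite, and in  *)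
(* the second one all but finitely many terms are at most 1 / p.              *)
Definition adele_abs (a : adele) : R :=
  Num.max `|adele_inf a|
    (if `[< finite_set P >]
     then sup (range (fun q : P => Qp_abs R (adele_fin a q)))
     else sup (range (fun q : P => Qp_abs R (adele_fin a q) / (val q)%:R))).

(* The infimum is a minimum, since Gamma_P is discrete in A_P; it does not    *)
(* depend on the representatives.                                             *)
Definition solenoid_dist (x y : solenoid) : R :=
  inf [set adele_abs (repr x - repr y - diag g) | g in Gamma].

(* delta_{n,N}: x *+ n is the point xi_n = n alpha + Gamma_P.                 *)
Definition delta (x : solenoid) (N n : nat) : \bar R :=
  \big[Order.min/+oo%E]_(1 <= m < N.+1 |
      0 < solenoid_dist (x *+ m) (x *+ n))
    (solenoid_dist (x *+ m) (x *+ n))%:E.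

Definition gap_count (x : solenoid) (N : nat) : nat :=
  size (undup [seq delta x N n | n <- iota 1 N]).

End Adele.

(* Main.v *)
Require Import Defs.
From mathcomp Require Import all_boot all_order all_algebra ring_quotient.
From mathcomp Require Import boolp classical_sets cardinality reals ereal normedtype.
From mathcomp Require Import zify ring lra.

Set Implicit Arguments.
Unset Strict Implicit.
Unset Printing Implicit Defensive.

Import Order.TTheory GRing.Theory Num.Theory.
Import numFieldNormedType.Exports.

Local Open Scope classical_set_scope.
Local Open Scope ring_scope.
Local Open Scope quotient_scope.

(** Distances between points of the orbit depend only on the difference of
    indices: the distance from [x *+ m] to [x *+ n] is [snorm (x *+ |m - n|)],
    where [snorm] is the quotient seminorm of [X_P].  Hence [delta x N n] is
    the least positive [snorm (x *+ k)] with [0 < k <= K], where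
    [K = maxn n.-1 (N - n)] is at least [(N - 1) / 2].

    At most three gaps.  Let [v0] be the largest value of [delta], taken at
    [n0], and suppose that there are three smaller values.  Each of them is some
    [snorm (x *+ k_i)] with [K < k_i < N], since a multiple [k <= K] would be
    seen from [n0].  Lift the three points to adeles of absolute value less than
    [v0].  Two of the lifts have real coordinates of the same sign, so that
    their difference is no longer than the longer one at the real place, by the
    sign condition, and at the finite places, by the ultrametric inequality
    ([adele_absB_same_sign]).  Thus [snorm (x *+ |k_i - k_j|) < v0], with
    [|k_i - k_j| <= K]; by the choice of [v0] this seminorm vanishes, so the two
    points are at the same distance from 0, and the two values coincide.

    Three gaps occur.  The finite places are made invisible: take
    [alpha = (t, 0, 0, ...)].  The elements of [Gamma] whose weighted absolute
    values at all [l] in [P] are less than [1 / (n + 1)] are exactly the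
    multiples of some integer [q], and the weighted absolute values of [q] are
    even at most [1 / (n + 2)], because their inverses are powers of primes,
    hence integers ([exists_modulus]).  So between [1 / (n + 2)] and
    [1 / (n + 1)] the seminorm of [k * alpha] is the distance from [k t] to
    [q Z], and it suffices to have three gaps on a circle of length [q], with
    the two smaller ones between these bounds.  For [t] slightly more than
    [q / h] the multiples [h - 1] and [h] just miss [q], on either side, at
    distances [r + e] and [r], while no smaller multiple comes so close
    ([orbit_gap_bounds]); [n], [h] and [e] are chosen so that
    [r = 1 / (n + 2)] and [r + e < 1 / (n + 1)].  With [N = 2 h - 3] points,
    the cut-off [K] takes the values [h - 2], [h - 1] and [h]. *)

(** * The absolute value of an adele *)

Section PadicAbs.
Variables (R : realType) (p : nat).
Implicit Types x y : Qp p.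

Lemma Qp_abs_ge0 x : 0 <= Qp_abs R x.
Proof.
rewrite -[x]reprK; have cv := @Qp_abs_cvg R p (repr x).
rewrite -(cvg_lim _ cv)//; apply: limr_ge; first exact: cvgP cv.
by apply: nearW => n; rewrite ler0q rat_abs_ge0.
Qed.

Lemma Qp_absN x : Qp_abs R (- x) = Qp_abs R x.
Proof.
rewrite -[x]reprK -rmorphN.
have cv := @Qp_abs_cvg R p (repr x); have cvN := @Qp_abs_cvg R p (- repr x).
apply: (cvg_unique _ cvN); first exact: norm_hausdorff.
by apply: cvg_trans cv; apply: near_eq_cvg; apply: nearW => n /=; rewrite rat_absN.
Qed.

Lemma Qp_absD x y : Qp_abs R (x + y) <= Num.max (Qp_abs R x) (Qp_abs R y).
Proof.
rewrite -[x]reprK -[y]reprK -rmorphD.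
have cx := @Qp_abs_cvg R p (repr x); have cy := @Qp_abs_cvg R p (repr y).
have cxy := @Qp_abs_cvg R p (repr x + repr y).
set u := repr x in cx cxy *; set v := repr y in cy cxy *.
suff h e : 0 < e -> Qp_abs R (\pi_(Qp p) (u + v)) <=
    Num.max (Qp_abs R (\pi_(Qp p) u)) (Qp_abs R (\pi_(Qp p) v)) + e.
  by apply/ler_addgt0Pr.
move=> e0; apply: (@ler_cvg_to _ _ _ _ _ _ _ _ cxy (cvg_cst _)).
near=> n => /=.
have hu : ratr (rat_abs p (u n)) < Qp_abs R (\pi_(Qp p) u) + e.
  near: n; apply: (cvgr_lt _ cx); lra.
have hv : ratr (rat_abs p (v n)) < Qp_abs R (\pi_(Qp p) v) + e.
  near: n; apply: (cvgr_lt _ cy); lra.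
have := rat_absD p (u n) (v n).
rewrite le_max -!(ler_rat R) => /orP[] /le_trans; apply.
  by apply: (le_trans (ltW hu)); rewrite lerD2r le_max lexx.
by apply: (le_trans (ltW hv)); rewrite lerD2r le_max lexx orbT.
Unshelve. all: by end_near.
Qed.

End PadicAbs.

(** The weight of the finite place [l]: the two formulas for the metric differ
    only by this factor. *)
Definition weight (R : realType) (P : set nat) (l : nat) : R :=
  if `[< finite_set P >] then 1 else l%:R^-1.

Section Weight.
Variables (R : realType) (P : set nat) (l : nat).
Hypothesis l_gt0 : (0 < l)%N.

Lemma weight_ge_inv : l%:R^-1 <= weight R P l.
Proof.
by rewrite /weight; case: ifP => // _; rewrite invf_le1 ?ler1n ?ltr0n.
Qed.

Lemma weight_gt0 : 0 < weight R P l.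
Proof. by apply: lt_le_trans weight_ge_inv; rewrite invr_gt0 ltr0n. Qed.

Lemma weight_le1 : weight R P l <= 1.
Proof.
by rewrite /weight; case: ifP => // _; rewrite invf_le1 ?ler1n ?ltr0n.
Qed.

End Weight.

Section AdeleAbs.
Variables (R : realType) (P : set nat).
Hypothesis P_prime : forall p : nat, P p -> prime p.
Hypothesis P_neq0 : P !=set0.
Implicit Types (a b : adele R P) (q : P).

Lemma P_val_gt0 q : (0 < val q)%N.
Proof. by apply/prime_gt0/P_prime; exact: set_valP. Qed.

(** All but finitely many coordinates are integral, and weights are at most 1.
    So the supremum in [adele_abs] is a genuine least upper bound, and
    inequalities between absolute values can be checked place by place. *)
Lemma adele_fin_bounded a :
  has_ubound (range (fun q => Qp_abs R (adele_fin a q) * weight R P (val q))).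
Proof.
have fin : finite_set [set q | ~ Qp_int R (adele_fin a q)].
  exact: (asboolW (valP a)).
have [M HM] : exists M : R, forall q, ~ Qp_int R (adele_fin a q) ->
    Qp_abs R (adele_fin a q) <= M.
  have /finite_seqP[s sE] := fin.
  exists (\sum_(q <- s) Qp_abs R (adele_fin a q)) => q Hq.
  have : q \in s by have : [set` s] q by rewrite -sE.
  move=> qs; rewrite (perm_big _ (perm_to_rem qs)) big_cons lerDl.
  by apply: sumr_ge0 => i _; exact: Qp_abs_ge0.
exists (Num.max 1 M) => _ [q _ <-].
apply: (@le_trans _ _ (Qp_abs R (adele_fin a q) * 1)).
  by apply: ler_wpM2l; [exact: Qp_abs_ge0|exact/weight_le1/P_val_gt0].
rewrite mulr1 le_max; have [i|/HM ->] := pselect (Qp_int R (adele_fin a q)).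
  by apply/orP; left.
by rewrite orbT.
Qed.

Lemma adele_absE a : adele_abs a = Num.max `|adele_inf a|
  (sup (range (fun q => Qp_abs R (adele_fin a q) * weight R P (val q)))).
Proof.
rewrite /adele_abs /weight; case: ifP => // _.
by under [in RHS]eq_fun do rewrite mulr1.
Qed.

Lemma adele_abs_leP a c : adele_abs a <= c <->
  `|adele_inf a| <= c /\
  forall q, Qp_abs R (adele_fin a q) * weight R P (val q) <= c.
Proof.
rewrite adele_absE ge_max; split=> [/andP[-> h]|[-> h]].
  split=> // q; apply: le_trans h.
  by apply: ub_le_sup; [exact: adele_fin_bounded|exists q].
apply: ge_sup => [|_ [q _ <-]//].
have [p Pp] := P_neq0; exists (Qp_abs R (adele_fin a (SigSub (mem_set Pp))) * weight R P p).
by exists (SigSub (mem_set Pp)).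
Qed.

Lemma le_adele_abs a : `|adele_inf a| <= adele_abs a.
Proof. by rewrite le_max lexx. Qed.

Lemma le_adele_abs_fin a q : Qp_abs R (adele_fin a q) * weight R P (val q) <= adele_abs a.
Proof. by have /adele_abs_leP[] := lexx (adele_abs a). Qed.

Lemma adele_infD a b : adele_inf (a + b) = adele_inf a + adele_inf b.
Proof. by []. Qed.

Lemma adele_finD a b q : adele_fin (a + b) q = adele_fin a q + adele_fin b q.
Proof. by []. Qed.

Lemma adele_infN a : adele_inf (- a) = - adele_inf a.
Proof. by []. Qed.

Lemma adele_finN a q : adele_fin (- a) q = - adele_fin a q.
Proof. by []. Qed.

Lemma adele_abs_ge0 a : 0 <= adele_abs a.
Proof. by apply: le_trans (le_adele_abs a). Qed.

Lemma adele_absN a : adele_abs (- a) = adele_abs a.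
Proof.
suff h b : adele_abs (- b) <= adele_abs b.
  by apply/le_anti; rewrite h /= -{1}[a]opprK h.
apply/adele_abs_leP; rewrite adele_infN normrN; split; first exact: le_adele_abs.
by move=> q; rewrite adele_finN Qp_absN le_adele_abs_fin.
Qed.

Lemma adele_absB_fin a b q : Qp_abs R (adele_fin (a - b) q) * weight R P (val q)
  <= Num.max (adele_abs a) (adele_abs b).
Proof.
rewrite adele_finD adele_finN; have := Qp_absD R (adele_fin a q) (- adele_fin b q).
rewrite Qp_absN le_max => /orP[] h; rewrite le_max; apply/orP; [left|right];
  apply: le_trans (le_adele_abs_fin _ q); apply: ler_wpM2r => //;
  exact/ltW/weight_gt0/P_val_gt0.
Qed.

Lemma adele_absB a b : adele_abs (a - b) <= adele_abs a + adele_abs b.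
Proof.
apply/adele_abs_leP; split.
  rewrite adele_infD adele_infN; apply: (le_trans (ler_normB _ _)).
  by apply: lerD; exact: le_adele_abs.
move=> q; apply: (le_trans (adele_absB_fin a b q)).
by rewrite ge_max lerDl lerDr !adele_abs_ge0.
Qed.

(** Real numbers of the same sign obey the ultrametric inequality for
    differences; this is where the pigeonhole on signs enters. *)
Lemma adele_absB_same_sign a b : (0 <= adele_inf a) = (0 <= adele_inf b) ->
  adele_abs (a - b) <= Num.max (adele_abs a) (adele_abs b).
Proof.
move=> ab; apply/adele_abs_leP; split; last exact: adele_absB_fin.
rewrite adele_infD adele_infN; have := le_adele_abs a; have := le_adele_abs b.
move: ab; move: (adele_inf a) (adele_inf b) (adele_abs a) (adele_abs b) => x y A B.
have [x0|x0] := lerP 0 x; have [y0|y0] := lerP 0 y => // _;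
  rewrite le_max !ler_norml => hy hx; apply/orP.
- by have [xy|xy] := lerP x y; [right|left]; lra.
- by have [xy|xy] := lerP x y; [left|right]; lra.
Qed.

End AdeleAbs.

(** * The seminorm of the solenoid *)

Section SolenoidNorm.
Variables (R : realType) (P : set nat).
Hypothesis P_prime : forall p : nat, P p -> prime p.
Hypothesis P_neq0 : P !=set0.
Implicit Types (a b : adele R P) (x y : solenoid R P).
Local Notation pi := (\pi_(solenoid R P)).

Lemma pi_diagP a b : pi a = pi b <-> exists2 g, Gamma P g & a - b = diag R P g.
Proof.
split=> [/eqP|h]; first by rewrite -Quotient.idealrBE => /asboolP.
by apply/eqP; rewrite -Quotient.idealrBE; apply/asboolP.
Qed.

Definition snorm x : R := inf [set adele_abs a | a in [set a | pi a = x]].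

Lemma snorm_has_lbound x :
  has_lbound [set adele_abs a | a in [set a | pi a = x]].
Proof. by exists 0 => _ [a _ <-]; exact: adele_abs_ge0. Qed.

Lemma snorm_set_neq0 x : [set adele_abs a | a in [set a | pi a = x]] !=set0.
Proof. by exists (adele_abs (repr x)); exists (repr x) => //=; rewrite reprK. Qed.

Lemma snorm_le a : snorm (pi a) <= adele_abs a.
Proof. by apply: ge_inf; [exact: snorm_has_lbound|exists a]. Qed.

Lemma le_snorm x c : (forall a, pi a = x -> c <= adele_abs a) -> c <= snorm x.
Proof.
by move=> h; apply: lb_le_inf; [exact: snorm_set_neq0|move=> _ [a /h ? <-]].
Qed.

Lemma snorm_lt x c : snorm x < c -> exists2 a, pi a = x & adele_abs a < c.
Proof. by move=> /(inf_lt (snorm_set_neq0 x))[_ [a ? <-]]; exists a. Qed.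

Lemma snorm_ge0 x : 0 <= snorm x.
Proof. by apply: le_snorm => a _; exact: adele_abs_ge0. Qed.

Lemma snormN x : snorm (- x) = snorm x.
Proof.
suff h y : snorm (- y) <= snorm y by apply/le_anti; rewrite h -{1}[x]opprK h.
apply: le_snorm => a <-; rewrite -raddfN; apply: (le_trans (snorm_le _)).
by rewrite adele_absN.
Qed.

Lemma snormB x y : snorm (x - y) <= snorm x + snorm y.
Proof.
apply/ler_addgt0Pr => e e0.
have e2 : 0 < e / 2 by rewrite divr_gt0.
have [a ax Ha] : exists2 a, pi a = x & adele_abs a < snorm x + e / 2.
  by apply: snorm_lt; rewrite ltrDl.
have [b By Hb] : exists2 b, pi b = y & adele_abs b < snorm y + e / 2.
  by apply: snorm_lt; rewrite ltrDl.
rewrite -ax -By -raddfB; apply: (le_trans (snorm_le _)).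
apply: (le_trans (adele_absB P_prime P_neq0 a b)); rewrite ax By; lra.
Qed.

Lemma snorm0 : snorm 0 = 0.
Proof.
apply/le_anti; rewrite snorm_ge0 andbT -(raddf0 pi).
apply: (le_trans (snorm_le _)); apply/adele_abs_leP => //.
split=> [|q]; first by rewrite normr0.
have -> : adele_fin 0 q = Qp_of_rat (val q) 0 by rewrite rmorph0.
by rewrite Qp_abs_rat rat_abs0 rmorph0 mul0r.
Qed.

Lemma solenoid_distE x y : solenoid_dist x y = snorm (x - y).
Proof.
rewrite /solenoid_dist /snorm; congr (inf _); apply/seteqP; split=> r [].
  move=> g Gg <-; exists (repr x - repr y - diag R P g) => //=.
  rewrite -[in RHS](reprK x) -[in RHS](reprK y) -raddfB; apply/esym/pi_diagP.
  by exists g => //; rewrite subKr.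
move=> a /= axy <-; have /pi_diagP[g Gg gE] : pi (repr x - repr y) = pi a.
  by rewrite axy -[in RHS](reprK x) -[in RHS](reprK y) -raddfB.
by exists g => //; rewrite -gE subKr.
Qed.

Lemma solenoid_dist_orbit x m n :
  solenoid_dist (x *+ m) (x *+ n) = snorm (x *+ (m - n + (n - m))).
Proof.
rewrite solenoid_distE; have [mn|/ltnW nm] := leqP m n.
  by rewrite -snormN opprB -mulrnBr//; congr (snorm (_ *+ _)); lia.
by rewrite -mulrnBr//; congr (snorm (_ *+ _)); lia.
Qed.

(** The indices [m] and [n] of two points of the orbit range over [1..N]: from
    [n], the differences in sight are those up to [maxn n.-1 (N - n)]. *)
Lemma delta_le x N n k : (1 <= n <= N)%N -> (0 < k <= maxn n.-1 (N - n))%N ->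
  0 < snorm (x *+ k) -> (delta x N n <= (snorm (x *+ k))%:E)%E.
Proof.
move=> nN kn k0; have [m mN mk] : exists2 m, (1 <= m <= N)%N & (m - n + (n - m) = k)%N.
  have [kn1|kn1] := leqP k n.-1; first by exists (n - k)%N; lia.
  by exists (n + k)%N; lia.
rewrite -mk -solenoid_dist_orbit /delta; apply: bigmin_inf_seq; rewrite ?lexx//.
  by rewrite mem_index_iota ltnS.
by rewrite solenoid_dist_orbit mk.
Qed.

Lemma le_delta x N n (c : R) : (1 <= n <= N)%N ->
  (forall k, (0 < k <= maxn n.-1 (N - n))%N -> 0 < snorm (x *+ k) ->
     c <= snorm (x *+ k)) -> (c%:E <= delta x N n)%E.
Proof.
move=> nN h; rewrite /delta big_seq_cond; apply: le_bigmin; first exact: leey.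
move=> m /andP[]; rewrite mem_index_iota ltnS => mN.
rewrite solenoid_dist_orbit => d0; rewrite lee_fin; apply: h => //.
suff : (m - n + (n - m))%N != 0%N by lia.
by apply: contraTneq d0 => ->; rewrite mulr0n snorm0 ltxx.
Qed.

Lemma delta_attained x N n : (1 <= n <= N)%N -> (delta x N n < +oo)%E ->
  exists2 k, (0 < k < N)%N & 0 < snorm (x *+ k) /\ delta x N n = (snorm (x *+ k))%:E.
Proof.
move=> nN dlt; pose attained v := v = +oo%E \/ exists2 k, (0 < k < N)%N &
  0 < snorm (x *+ k) /\ v = (snorm (x *+ k))%:E.
suff : attained (delta x N n) by case=> // dE; rewrite dE ltxx in dlt.
rewrite /delta big_seq_cond; apply: (big_ind attained).
- by left.
- by move=> u v hu hv; case: leP.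
- move=> m /andP[]; rewrite mem_index_iota ltnS => mN.
  rewrite solenoid_dist_orbit => d0; right; exists (m - n + (n - m))%N => //.
  suff : (m - n + (n - m))%N != 0%N by lia.
  by apply: contraTneq d0 => ->; rewrite mulr0n snorm0 ltxx.
Qed.

End SolenoidNorm.

(** * At most three gaps *)

Section AtMostThreeGaps.
Variables (R : realType) (P : set nat).
Hypothesis P_prime : forall p : nat, P p -> prime p.
Hypothesis P_neq0 : P !=set0.
Implicit Types (a b : adele R P) (x : solenoid R P).
Local Notation pi := (\pi_(solenoid R P)).

(** The difference of two lifts of the same sign is shorter than [c], so it
    represents a point at distance 0 from the origin when no multiple up to [K]
    has a positive seminorm less than [c]. *)
Lemma snorm_eq_of_same_sign x K c a b i j :
  (forall k, (0 < k <= K)%N -> 0 < snorm (x *+ k) -> c <= snorm (x *+ k)) ->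
  pi a = x *+ i -> pi b = x *+ j -> adele_abs a < c -> adele_abs b < c ->
  (0 <= adele_inf a) = (0 <= adele_inf b) ->
  (i < j <= i + K)%N -> snorm (x *+ i) = snorm (x *+ j).
Proof.
move=> short ai bj ac bc ab ij.
have xji : x *+ (j - i) = x *+ j - x *+ i by rewrite mulrnBr; [|lia].
have lt_c : snorm (x *+ (j - i)) < c.
  rewrite xji -ai -bj -raddfB; apply: (le_lt_trans (snorm_le _)).
  apply: (le_lt_trans (adele_absB_same_sign P_prime P_neq0 (esym ab))).
  by rewrite gt_max bc ac.
have z : snorm (x *+ (j - i)) = 0.
  apply/eqP; case: eqP => // /eqP nz; have : c <= snorm (x *+ (j - i)).
    by apply: short; [lia|rewrite lt0r nz snorm_ge0].
  by rewrite leNgt lt_c.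
apply/le_anti/andP; split.
  have := snormB P_prime P_neq0 (x *+ j) (x *+ (j - i)).
  by rewrite z addr0 {1}xji subKr.
have := snormB P_prime P_neq0 (x *+ (j - i)) (- (x *+ i)).
by rewrite z add0r (snormN P_prime P_neq0 (x *+ i)) opprK xji subrK.
Qed.

Lemma no_three_short_multiples x K L c k1 k2 k3 : (L <= K + K)%N ->
  (forall k, (0 < k <= K)%N -> 0 < snorm (x *+ k) -> c <= snorm (x *+ k)) ->
  (K < k1 <= L)%N -> (K < k2 <= L)%N -> (K < k3 <= L)%N ->
  snorm (x *+ k1) < c -> snorm (x *+ k2) < c -> snorm (x *+ k3) < c ->
  uniq [:: snorm (x *+ k1); snorm (x *+ k2); snorm (x *+ k3)] -> False.
Proof.
move=> LK short K1 K2 K3 /snorm_lt[a1 a1x a1c] /snorm_lt[a2 a2x a2c].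
move=> /snorm_lt[a3 a3x a3c]; rewrite /= !inE andbT negb_or => /andP[/andP[]].
have same i j a b : (K < i <= L)%N -> (K < j <= L)%N ->
    pi a = x *+ i -> pi b = x *+ j -> adele_abs a < c -> adele_abs b < c ->
    (0 <= adele_inf a) = (0 <= adele_inf b) -> snorm (x *+ i) = snorm (x *+ j).
  move=> Ki Kj ai bj ac bc ab; have [ij|ji|->//] := ltngtP i j.
    by apply: (snorm_eq_of_same_sign short ai bj ac bc ab); lia.
  by apply/esym/(snorm_eq_of_same_sign short bj ai bc ac (esym ab)); lia.
move=> /eqP n12 /eqP n13 /eqP n23.
have := @same _ _ _ _ K1 K2 a1x a2x a1c a2c.
have := @same _ _ _ _ K1 K3 a1x a3x a1c a3c.
have := @same _ _ _ _ K2 K3 a2x a3x a2c a3c.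
by case: (0 <= _); case: (0 <= _); case: (0 <= _) => // *; auto.
Qed.

Lemma gap_count_le3 x N : (gap_count x N <= 3)%N.
Proof.
rewrite leqNgt; apply/negP; rewrite /gap_count.
set s := undup _; pose t := sort (fun u v : \bar R => (v <= u)%O) s.
rewrite -(size_sort (fun u v : \bar R => (v <= u)%O) s) -/t => t4.
have tuniq : uniq t by rewrite sort_uniq undup_uniq.
have tsort : sorted (fun u v : \bar R => (v <= u)%O) t.
  by apply: sort_sorted => u v; exact: le_total.
have tmem v : v \in t -> exists2 n, (1 <= n <= N)%N & v = delta x N n.
  rewrite mem_sort mem_undup => /mapP[n]; rewrite mem_iota => nN ->.
  by exists n => //; lia.
move: t tuniq tsort tmem t4 => [|v0 [|v1 [|v2 [|v3 t]]]] //= tu ts tmem _.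
have [n0 nN0 v0E] := tmem v0 (mem_head _ _).
have lt0 v : v \in [:: v1; v2; v3] -> (v < v0)%O /\
    exists2 n, (1 <= n <= N)%N & v = delta x N n.
  move=> vin; split; last by apply: tmem; move: vin; rewrite !inE;
    case/or3P => ->; rewrite ?orbT.
  move: ts tu => /and4P[le1 le2 le3 _]; rewrite !inE !negb_or.
  move=> /andP[/and4P[n1 n2 n3 _] _]; rewrite lt_neqAle.
  move: vin; rewrite !inE => /or3P[] /eqP ->; rewrite eq_sym ?n1 ?n2 ?n3 //=.
    exact: le_trans le2 le1.
  exact: le_trans le3 (le_trans le2 le1).
(* The smaller values are attained only by multiples out of sight of n0. *)
set K := maxn n0.-1 (N - n0).
have NK : (N.-1 <= K + K)%N by rewrite {}/K; clear -nN0; lia.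
have att v : v \in [:: v1; v2; v3] -> exists2 k, (K < k <= N.-1)%N &
    v = (snorm (x *+ k))%:E.
  move=> /lt0[vv0 [n nN vE]].
  have [k kN [k0 dE]] := @delta_attained R P P_prime P_neq0 x N n nN
    (lt_le_trans (eq_ind _ (fun u => (u < v0)%O) vv0 _ vE) (leey _)).
  exists k; last by rewrite vE.
  rewrite ltnNge; apply/andP; split; last by clear -kN; lia.
  apply/negP => kK; have := @delta_le R P P_prime P_neq0 x N n0 k nN0 _ k0.
  by rewrite -v0E -dE -vE leNgt vv0 => h; suff: false by []; apply: h; rewrite kK andbT; case/andP: kN.
have [k1 K1 v1E] : exists2 k, (K < k <= N.-1)%N & v1 = (snorm (x *+ k))%:E.
  by apply: att; rewrite mem_head.
have [k2 K2 v2E] : exists2 k, (K < k <= N.-1)%N & v2 = (snorm (x *+ k))%:E.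
  by apply: att; rewrite !inE eqxx orbT.
have [k3 K3 v3E] : exists2 k, (K < k <= N.-1)%N & v3 = (snorm (x *+ k))%:E.
  by apply: att; rewrite !inE eqxx !orbT.
have l1 : (v1 < v0)%O by have [] := lt0 v1; rewrite ?mem_head.
have l2 : (v2 < v0)%O by have [] := lt0 v2; rewrite // !inE eqxx orbT.
have l3 : (v3 < v0)%O by have [] := lt0 v3; rewrite // !inE eqxx !orbT.
(* v0 may be infinite: c is a real number between the smaller values and v0. *)
have [c [c1 c2 c3 c0]] : exists c : R, [/\ snorm (x *+ k1) < c,
    snorm (x *+ k2) < c, snorm (x *+ k3) < c & (c%:E <= v0)%E].
  rewrite v1E in l1; rewrite v2E in l2; rewrite v3E in l3.
  case: v0 {tu ts tmem v0E lt0 att} l1 l2 l3 => [r||] // l1 l2 l3.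
    by exists r; split => //; rewrite -lte_fin.
  exists (snorm (x *+ k1) + snorm (x *+ k2) + snorm (x *+ k3) + 1).
  have := snorm_ge0 (x *+ k1); have := snorm_ge0 (x *+ k2).
  have := snorm_ge0 (x *+ k3) => *; split; rewrite ?leey//; lra.
apply: (@no_three_short_multiples x K N.-1 c k1 k2 k3 NK) => //.
- move=> k kK k0; rewrite -lee_fin (le_trans c0)// v0E.
  exact: (@delta_le R P P_prime P_neq0).
- move: tu; rewrite v1E v2E v3E !inE /= !inE !negb_or -!andbA !andbT.
  by rewrite !eqe; case/and5P => _ _ _ _ /and5P[-> -> _ -> _].
Qed.

End AtMostThreeGaps.

(** * The elements of Gamma that are small at all finite places *)

Section RationalAbs.
Implicit Types (l : nat) (x : rat).

Lemma rat_abs_int_le1 l (m : int) : prime l -> rat_abs l m%:~R <= 1.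
Proof.
move=> pl; have [->|m0] := eqVneq m 0; first by rewrite rat_abs0.
rewrite -[m%:~R]divr1 -[1 in X in rat_abs _ X]/(1%:~R) rat_abs_frac// logn1.
rewrite sub0r -invr_expz invf_le1 ?exprz_gt0 ?ltr0n ?prime_gt0//.
by rewrite exprn_ege1// ler1n prime_gt0.
Qed.

Lemma rat_abs_inv_neq l p : prime l -> prime p -> l != p -> rat_abs l p%:R^-1 = 1.
Proof.
move=> pl pp lp; have p0 : (p%:Z : int) != 0 by rewrite eqz_nat -lt0n prime_gt0.
have := @rat_abs_frac l 1 p%:Z isT p0; rewrite /= mul1r -pmulrn => ->.
by rewrite logn1 (logn_prime _ pp) (negbTE lp) subrr expr0z.
Qed.

Lemma rat_abs_dvd l (k : nat) : prime l -> (0 < k)%N -> (l %| k)%N ->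
  rat_abs l k%:R <= l%:R^-1.
Proof.
move=> pl k0 lk; have := @rat_abs_frac l k%:Z 1; rewrite /= divr1 -pmulrn => ->//.
  rewrite logn1 sub0r -invr_expz lef_pV2 ?posrE ?exprz_gt0 ?ltr0n ?prime_gt0//.
  by rewrite -[leLHS]expr1z ler_eXz2l ?ltr1n ?prime_gt1// lez_nat logn_gt0 mem_primes pl k0.
by rewrite eqz_nat -lt0n.
Qed.

Lemma rat_absX l x n : rat_abs l (x ^+ n) = rat_abs l x ^+ n.
Proof.
by elim: n => [|n IHn]; rewrite ?expr0 ?rat_abs1// !exprS rat_absM IHn.
Qed.

(** A prime factor of the denominator does not divide the numerator. *)
Lemma rat_abs_le1_int x : (forall l, prime l -> rat_abs l x <= 1) ->
  exists m : int, x = m%:~R.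
Proof.
move=> h; exists (numq x); suff d1 : denq x = 1.
  by rewrite -[LHS]divq_num_den d1 divr1.
have [x0|x0] := eqVneq x 0; first by rewrite x0.
suff : absz (denq x) = 1%N by case: (denq x) (denq_gt0 x) => // n _ /= ->.
apply/eqP; rewrite eqn_leq absz_gt0 denq_eq0 andbT leqNgt; apply/negP => /pdivP.
case=> l pl ld; have := h l pl; rewrite /rat_abs (negbTE x0).
have ln : logn l `|numq x| = 0%N.
  apply/eqP; rewrite -leqn0 leqNgt; apply/negP; rewrite logn_gt0 mem_primes.
  move=> /and3P[_ _ lnum]; have := coprime_num_den x; rewrite /coprime => /eqP g1.
  have : (l %| 1)%N by rewrite -g1 dvdn_gcd lnum.
  by rewrite dvdn1 => /eqP l1; rewrite l1 in pl.
rewrite ln subr0 leNgt -exprnP exprn_egt1 ?ltr1n ?prime_gt1//.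
by rewrite -lt0n logn_gt0 mem_primes pl absz_gt0 denq_eq0 ld.
Qed.

End RationalAbs.

(** The inverse of a power [l ^ z] that is less than 1 is an integer: no such
    power lies strictly between the inverses of two consecutive integers. *)
Lemma ltn_invr_natX (R : realType) (l n : nat) (z : int) : (0 < l)%N ->
  (l%:R : R) ^ z < n.+1%:R^-1 -> (l%:R : R) ^ z <= n.+2%:R^-1.
Proof.
move=> l0; case: z => k.
  move=> /lt_le_trans/(_ (_ : _ <= 1)); rewrite invf_le1 ?ltr0n// ler1n => /(_ isT).
  by rewrite ltNge exprn_ege1// ler1n.
rewrite NegzE -exprnN -natrX ltf_pV2 ?posrE ?ltr0n ?expn_gt0 ?l0//.
by rewrite lef_pV2 ?posrE ?ltr0n ?expn_gt0 ?l0// ltr_nat ler_nat.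
Qed.

Section Modulus.
Variables (R : realType) (P : set nat).
Hypothesis P_prime : forall p : nat, P p -> prime p.
Implicit Types (g : rat) (l : nat).

Lemma Gamma_rat_abs_le1 g l : Gamma P g -> prime l -> ~ P l -> rat_abs l g <= 1.
Proof.
move=> Gg pl nPl; pose S : set rat := [set x | rat_abs l x <= 1].
apply: (Gg S); split; last first.
  move=> _ [p Pp <-]; rewrite /S /= (rat_abs_inv_neq pl (P_prime Pp))//.
  by apply: contra_notN nPl => /eqP ->.
split=> [|x y /set_mem xS /set_mem yS|x y /set_mem xS /set_mem yS]; apply/mem_set.
- by rewrite /S /= rat_abs1.
- by apply: le_trans (rat_absB l x y) _; rewrite ge_max xS.
- by rewrite /S /= rat_absM mulr_ile1 ?rat_abs_ge0.
Qed.

Lemma Gamma1 : Gamma P 1.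
Proof. by move=> S [[S1 _ _] _]; apply: set_mem. Qed.

Lemma Gamma_int (m : int) : Gamma P m%:~R.
Proof.
have GN g : Gamma P g -> Gamma P (- g).
  by move=> Gg; rewrite -sub0r; exact: (GammaB (@Gamma0 P) Gg).
have GD g g' : Gamma P g -> Gamma P g' -> Gamma P (g + g').
  by move=> Gg Gg'; rewrite -[g']opprK; exact: (GammaB Gg (GN _ Gg')).
have Gn (n : nat) : Gamma P n%:R.
  by elim: n => [|n IHn]; [exact: Gamma0|rewrite -natr1; exact: GD Gamma1].
by case: m => n; [exact: (Gn n)|rewrite NegzE rmorphN; exact: (GN _ (Gn n.+1))].
Qed.

(** Smallness at the finite places of [P] only; the real place is free. *)
Definition fin_small (c : R) g :=
  forall l, P l -> ratr (rat_abs l g) * weight R P l < c.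

(** Both with and without the weight [1 / l], the value is 0 or a power of [l]. *)
Lemma fin_small_gap n g l : fin_small n.+1%:R^-1 g -> P l ->
  ratr (rat_abs l g) * weight R P l <= n.+2%:R^-1.
Proof.
move=> gs Pl; have := gs l Pl; have pl := P_prime Pl.
rewrite /rat_abs; case: ifP => _; first by rewrite rmorph0 mul0r invr_ge0.
move: (_ - _) => z; rewrite fmorphXz rmorph_nat.
have [z' ->] : exists z', (l%:R : R) ^ z * weight R P l = l%:R ^ z'.
  rewrite /weight; case: ifP => _; first by exists z; rewrite mulr1.
  exists (z - 1); rewrite expfzDr ?pnatr_eq0 -?lt0n ?prime_gt0//.
by apply: ltn_invr_natX; rewrite prime_gt0.
Qed.

(** Even in the weighted case the bound gives [|g|_l < l], and the values of
    [|.|_l] are powers of [l]. *)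
Lemma fin_small_le1 n g l : fin_small n.+1%:R^-1 g -> P l -> rat_abs l g <= 1.
Proof.
move=> gs Pl; have pl := P_prime Pl.
have lt_l : ratr (rat_abs l g) < (l%:R : R).
  have h := lt_le_trans (gs l Pl) (_ : n.+1%:R^-1 <= 1).
  have : ratr (rat_abs l g) * l%:R^-1 < 1 :> R.
    apply: le_lt_trans (h _); last by rewrite invf_le1 ?ltr0n// ler1n.
    by apply: ler_wpM2l; rewrite ?ler0q ?rat_abs_ge0 ?weight_ge_inv ?prime_gt0.
  by rewrite ltr_pdivrMr ?mul1r// ltr0n prime_gt0.
move: lt_l; rewrite /rat_abs; case: ifP => // _; move: (_ - _) => z.
rewrite fmorphXz rmorph_nat; have l1 : 1 < (l%:R : R) by rewrite ltr1n prime_gt1.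
rewrite -[ltRHS]expr1z ltr_eXz2l// => z1.
have l1' : 1 < (l%:R : rat) by rewrite ltr1n prime_gt1.
by rewrite -[leRHS](expr0z (l%:R : rat)) ler_eXz2l//; lia.
Qed.

Lemma Gamma_small_int n g : Gamma P g -> fin_small n.+1%:R^-1 g ->
  exists m : int, g = m%:~R.
Proof.
move=> Gg gs; apply: rat_abs_le1_int => l pl.
have [Pl|nPl] := pselect (P l); first exact: fin_small_le1 gs Pl.
exact: Gamma_rat_abs_le1.
Qed.

Lemma fin_smallB c g g' : fin_small c g -> fin_small c g' -> fin_small c (g - g').
Proof.
move=> gs gs' l Pl; have := gs l Pl; have := gs' l Pl.
have := rat_absB l g g'; have w0 := weight_gt0 R P (prime_gt0 (P_prime Pl)).
rewrite le_max -!(ler_rat R) => /orP[] h a b.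
  by apply: le_lt_trans b; rewrite ler_pM2r.
by apply: le_lt_trans a; rewrite ler_pM2r.
Qed.

Lemma fin_smallMz c g (m : int) : fin_small c g -> fin_small c (m%:~R * g).
Proof.
move=> gs l Pl; apply: le_lt_trans (gs l Pl).
have pl := P_prime Pl; rewrite ler_pM2r ?weight_gt0 ?prime_gt0// ler_rat rat_absM.
by rewrite ler_piMl ?rat_abs_ge0 ?rat_abs_int_le1.
Qed.

(** Only finitely many places constrain [k]: all of them if [P] is finite, and
    otherwise those with [1 / l] not already small enough.  A high power of the
    factorial of a bound for them is divisible enough at each. *)
Lemma exists_small_nat n : exists2 k : nat, (0 < k)%N & fin_small n.+1%:R^-1 k%:R.
Proof.
have [C HC] : exists C, forall l, P l -> n.+2%:R^-1 < weight R P l -> (l <= C)%N.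
  rewrite /weight; case: asboolP => [/finite_seqP[s ->]|_].
    exists (\max_(l <- s) l)%N => l /= ls _.
    exact: (@leq_bigmax_seq _ s xpredT id).
  exists n.+1 => l Pl; have l0 := prime_gt0 (P_prime Pl).
  by rewrite ltf_pV2 ?posrE ?ltr0n// ltr_nat ltnS.
exists (C`! ^ n.+1)%N; first by rewrite expn_gt0 fact_gt0.
move=> l Pl; have pl := P_prime Pl; have l0 := prime_gt0 pl.
have [small_w|large_w] := leP (weight R P l) n.+2%:R^-1.
  apply: (@le_lt_trans _ _ n.+2%:R^-1); last by rewrite ltf_pV2 ?posrE ?ltr0n// ltr_nat.
  apply: le_trans small_w; apply: ler_piMl; first exact/ltW/weight_gt0.
  rewrite -(rmorph1 (@ratr R)) ler_rat.
  exact: (rat_abs_int_le1 (C`! ^ n.+1)%N pl).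
have lC : (l %| C`!)%N by rewrite dvdn_fact// l0 HC.
have h : rat_abs l (C`! ^ n.+1)%:R <= (2 ^ n.+1)%:R^-1.
  rewrite !natrX rat_absX -exprVn; apply: lerXn2r; rewrite ?nnegrE ?rat_abs_ge0//.
  apply: (le_trans (rat_abs_dvd pl (fact_gt0 C) lC)).
  by rewrite lef_pV2 ?posrE ?ltr0n// ler_nat prime_gt1.
apply: (@le_lt_trans _ _ (ratr (2 ^ n.+1)%:R^-1 * 1)).
  apply: ler_pM; rewrite ?ler0q ?rat_abs_ge0 ?ler_rat ?weight_le1//.
  exact/ltW/weight_gt0.
rewrite mulr1 fmorphV rmorph_nat ltf_pV2 ?posrE ?ltr0n ?expn_gt0// ltr_nat.
exact: ltn_expl.
Qed.

(** The small elements form a nonzero subgroup of [Z]; its positive generator is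
    not 1, because [|1|_p] is not small for the given [p <= n + 1]. *)
Lemma exists_modulus n p : P p -> (p <= n.+1)%N -> exists q : nat, [/\ (1 < q)%N,
  forall l, P l -> ratr (rat_abs l q%:R) * weight R P l <= n.+2%:R^-1 &
  forall g, Gamma P g -> fin_small n.+1%:R^-1 g -> exists m : int, g = m%:~R * q%:R].
Proof.
move=> Pp pn; pose A k := (0 < k)%N && `[< fin_small n.+1%:R^-1 k%:R >].
have exA : exists k, A k.
  by have [k k0 ks] := exists_small_nat n; exists k; rewrite /A k0; apply/asboolP.
have [q /andP[q0 /asboolP qs] qmin] := ex_minnP exA.
exists q; split=> [|l Pl|g Gg gs].
- rewrite ltn_neqAle q0 andbT; apply/eqP => q1.
  have := qs p Pp; rewrite -q1 rat_abs1 rmorph1 mul1r ltNge => /negP; apply.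
  apply: le_trans (weight_ge_inv R P (prime_gt0 (P_prime Pp))).
  by rewrite lef_pV2 ?posrE ?ltr0n ?(prime_gt0 (P_prime Pp))// ler_nat.
- exact: fin_small_gap.
have [m gE] := Gamma_small_int Gg gs.
exists (m %/ q)%Z; have q0' : (q%:Z : int) != 0 by rewrite eqz_nat -lt0n.
have rs : fin_small n.+1%:R^-1 (m %% q)%Z%:~R.
  rewrite /modz rmorphB rmorphM /= -gE; apply: fin_smallB => //.
  exact: fin_smallMz.
have := modz_ge0 m q0'; have := ltz_pmod m (_ : 0 < q%:Z); rewrite ltz_nat => /(_ q0).
case rE : (m %% q)%Z rs => [r|//] rs rq _.
have r0 : r = 0%N.
  apply/eqP; rewrite -leqn0 leqNgt; apply/negP => r0.
  by have := qmin r; rewrite /A r0 leqNgt -ltz_nat rq => /(_ (asboolT rs)).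
by rewrite gE {1}(divz_eq m q) rE r0 addr0 rmorphM.
Qed.

End Modulus.

(** * Three gaps occur *)

Section ThreeGapsOccur.
Variables (R : realType) (P : set nat).
Hypothesis P_prime : forall p : nat, P p -> prime p.
Hypothesis P_neq0 : P !=set0.
Local Notation pi := (\pi_(solenoid R P)).

Lemma real_adele_subproof (t : R) : (t, 0 : Qprod P) \in @adele_pred R P.
Proof.
apply/asboolP; rewrite (_ : [set _ | _] = set0)// -subset0 => q /=; apply.
by rewrite -(subrr 1); apply: Qp_intB; exact: Qp_int1.
Qed.

Definition real_adele t : adele R P := Adele (real_adele_subproof t).

Lemma real_adeleMn t j : real_adele t *+ j = real_adele (t *+ j).
Proof.
elim: j => [|j IHj]; first by apply/val_inj; rewrite !mulr0n.
by rewrite mulrS IHj; apply/val_inj; congr pair; rewrite /= ?mulrS ?add0r.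
Qed.

Lemma pi_real_adeleMn t j : pi (real_adele t) *+ j = pi (real_adele (t *+ j)).
Proof. by rewrite -real_adeleMn raddfMn. Qed.

Lemma adele_abs_realB_leP t g c : adele_abs (real_adele t - diag R P g) <= c <->
  `|t - ratr g| <= c /\
  forall l, P l -> ratr (rat_abs l g) * weight R P l <= c.
Proof.
have finE (q : P) : Qp_abs R (adele_fin (real_adele t - diag R P g) q)
    = ratr (rat_abs (val q) g).
  rewrite -Qp_abs_rat -[RHS]Qp_absN; congr (Qp_abs R _).
  exact: add0r.
split=> [/(adele_abs_leP P_prime P_neq0)[h1 h2]|[h1 h2]].
  split=> // l Pl; have := h2 (SigSub (mem_set Pl)); by rewrite finE.
apply/(adele_abs_leP P_prime P_neq0); split=> // q; rewrite finE.
by apply: h2; exact: set_valP.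
Qed.

Variables (n q : nat).
Hypothesis q_small : forall l, P l -> ratr (rat_abs l q%:R) * weight R P l <= n.+2%:R^-1.
Hypothesis q_gen : forall g, Gamma P g -> fin_small P (n.+1%:R^-1 : R) g ->
  exists m : int, g = m%:~R * q%:R.

(** Subtracting an element of [Gamma] outside [q Z] costs at least [1 / (n + 1)]
    at some finite place, so below that bound only the real distance to [q Z]
    counts. *)
Lemma le_snorm_real t j c : c <= n.+1%:R^-1 ->
  (forall m : int, c <= `|t *+ j - m%:~R * q%:R|) -> c <= snorm (pi (real_adele t) *+ j).
Proof.
move=> cn ct; rewrite pi_real_adeleMn; apply: le_snorm => a.
move/esym/pi_diagP=> [g Gg aE]; have {aE} -> : a = real_adele (t *+ j) - diag R P g.
  by rewrite -aE subKr.
have [h1 h2] := (adele_abs_realB_leP (t *+ j) g _).1 (lexx _).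
have [gs|ngs] := pselect (fin_small P (n.+1%:R^-1 : R) g).
  have [m gE] := q_gen Gg gs; apply: le_trans h1; rewrite gE rmorphM /= ratr_int ratr_nat.
  exact: ct.
apply: (le_trans cn); have [l Pl /negP] : exists2 l, P l &
    ~ (ratr (rat_abs l g) * weight R P l < n.+1%:R^-1).
  by apply: contrapT => /forall2NP h; apply: ngs => l Pl; have [|/contrapT] := h l.
by rewrite -leNgt => /le_trans; apply; exact: h2.
Qed.

Lemma snorm_real_le t j c : n.+2%:R^-1 <= c -> `|t *+ j - q%:R| <= c ->
  snorm (pi (real_adele t) *+ j) <= c.
Proof.
move=> nc tc; rewrite pi_real_adeleMn.
have -> : pi (real_adele (t *+ j)) = pi (real_adele (t *+ j) - diag R P q%:R).
  by apply/pi_diagP; exists q%:R; [exact: (@Gamma_int P q)|rewrite subKr].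
apply: (le_trans (snorm_le _)); apply/adele_abs_realB_leP; rewrite ratr_nat.
by split=> // l Pl; apply: le_trans nc; exact: q_small.
Qed.

End ThreeGapsOccur.

(** On the circle of length [q = 2 r h], the step [t = 2 r + e] satisfies
    [h t = q + r] and [(h - 1) t = q - (r + e)].  The earlier multiples stay
    within the circle, at distance at least [t] from both ends. *)
Lemma orbit_gap_bounds (R : realType) (h j : nat) (r e : R) (m : int) :
  (4 <= h)%N -> (0 < j <= h)%N -> 0 < r -> 0 < e -> e * h%:R = r ->
  let d := `|(2 * r + e) *+ j - m%:~R * (2 * r * h%:R)| in
  [/\ r <= d, (j <= h.-1)%N -> r + e <= d & (j <= h - 2)%N -> 2 * r + e <= d].
Proof.
move=> h4 /andP[j0 jh] r0 e0 ehr.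
have j1 : 1 <= j%:R :> R by rewrite ler1n.
have H4 : 4 <= h%:R :> R by rewrite ler_nat.
have jh' : j%:R <= h%:R :> R by rewrite ler_nat.
rewrite -mulr_natr; set J := j%:R in j1 jh' *; set H := h%:R in ehr H4 jh' *.
move=> d; have [m0|m1] := leP m 0.
  have M0 : m%:~R <= 0 :> R by rewrite (ler_int _ _ 0).
  have dle : 2 * r + e <= d.
    have rH0 : 0 <= - m%:~R * (r * H) by rewrite mulr_ge0 ?mulr_ge0//; lra.
    have J0 : 0 <= (2 * r + e) * (J - 1) by rewrite mulr_ge0//; lra.
    by apply: le_trans (ler_norm _); lra.
  by split=> *; lra.
have [jh1|jh1] := leqP j h.-1; last first.
  have jE : j = h by lia.
  have JH : J = H by rewrite /J jE.
  split=> [|?|?]; [|lia..].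
  have [m2|m2] := leP m 1.
    have m_eq : m = 1 by lia.
    by apply: le_trans (ler_norm _); rewrite m_eq mul1r JH; lra.
  have M2 : 2 <= m%:~R :> R by rewrite (ler_int _ 2).
  have rH0 : 0 <= (m%:~R - 2) * (r * H) by rewrite mulr_ge0 ?mulr_ge0//; lra.
  have rH1 : 0 <= r * (H - 1) by rewrite mulr_ge0//; lra.
  by rewrite /d -normrN; apply: le_trans (ler_norm _); rewrite JH; lra.
have M1 : 1 <= m%:~R :> R by rewrite (ler_int _ 1).
have J1 : J <= H - 1.
  by rewrite lerBrDr natr1 ler_nat; lia.
have rH : r * H <= m%:~R * (r * H) by rewrite ler_peMl// mulr_ge0//; lra.
have dge : 2 * r * H - (2 * r + e) * J <= d.
  rewrite /d -normrN opprB; apply: le_trans (ler_norm _); lra.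
split=> [|_|jh2].
- apply: le_trans dge.
  have : 0 <= (2 * r + e) * (H - 1 - J) by rewrite mulr_ge0//; lra.
  by lra.
- apply: le_trans dge.
  have : 0 <= (2 * r + e) * (H - 1 - J) by rewrite mulr_ge0//; lra.
  by lra.
(* (h - 2) t falls short of q by 3 r + 2 e. *)
have J2 : J <= H - 2 by rewrite lerBrDr -natrD ler_nat; lia.
have : 0 <= (2 * r + e) * (H - 2 - J) by rewrite mulr_ge0//; lra.
by move=> ?; apply: le_trans dge; lra.
Qed.

(** The points [h - 1], [h] and [h + 1] among [2 h - 3] see the differences up to
    [h - 2], [h - 1] and [h], respectively. *)
Lemma gap_count_ge3 (R : realType) (P : set nat)
    (P_prime : forall p : nat, P p -> prime p) (P_neq0 : P !=set0)
    (x : solenoid R P) (h : nat) (r s c : R) :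
  (4 <= h)%N -> 0 < r -> r < s -> s < c ->
  (forall j, (0 < j <= h - 2)%N -> c <= snorm (x *+ j)) ->
  (forall j, (0 < j <= h.-1)%N -> s <= snorm (x *+ j)) ->
  (forall j, (0 < j <= h)%N -> r <= snorm (x *+ j)) ->
  snorm (x *+ h.-1) <= s -> snorm (x *+ h) <= r ->
  (3 <= gap_count x (h + h - 3))%N.
Proof.
move=> h4; set N := (h + h - 3)%N.
have [N0 N1 N2] : [/\ (1 <= h.-1 <= N)%N, (1 <= h <= N)%N & (1 <= h.+1 <= N)%N].
  by rewrite /N; split; lia.
have [M0 M1 M2] : [/\ maxn h.-1.-1 (N - h.-1) = (h - 2)%N,
    maxn h.-1 (N - h) = h.-1 & maxn h (N - h.+1) = h].
  by rewrite /N; split; lia.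
have [hp1 hp] : (0 < h.-1 <= h.-1)%N /\ (0 < h <= h)%N by lia.
move=> r0 rs sc low0 low1 low2 up1 up2.
have d0 : (s%:E < delta x N h.-1)%E.
  apply: (@lt_le_trans _ _ c%:E); first by rewrite lte_fin.
  by apply: le_delta => // k; rewrite M0 => /low0.
have d1 : (delta x N h <= s%:E)%E.
  apply: (@le_trans _ _ (snorm (x *+ h.-1))%:E); last by rewrite lee_fin.
  apply: delta_le => //; first by rewrite M1.
  exact: lt_le_trans (lt_trans r0 rs) (low1 _ hp1).
have d1' : (r%:E < delta x N h)%E.
  apply: (@lt_le_trans _ _ s%:E); first by rewrite lte_fin.
  by apply: le_delta => // k; rewrite M1 => /low1.
have d2 : (delta x N h.+1 <= r%:E)%E.
  apply: (@le_trans _ _ (snorm (x *+ h))%:E); last by rewrite lee_fin.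
  apply: delta_le => //; first by rewrite M2.
  exact: lt_le_trans r0 (low2 _ hp).
have d01 := le_lt_trans d1 d0; have d12 := le_lt_trans d2 d1'.
apply: (@uniq_leq_size _ [:: delta x N h.-1; delta x N h; delta x N h.+1]).
  by rewrite /= !inE (gt_eqF d01) (gt_eqF d12) (gt_eqF (lt_trans d12 d01)).
have mem k : (1 <= k <= N)%N -> delta x N k \in undup [seq delta x N n | n <- iota 1 N].
  by move=> kN; rewrite mem_undup map_f// mem_iota add1n ltnS.
by move=> v; rewrite !inE => /or3P[] /eqP ->; exact: mem.
Qed.

Lemma three_gaps_occur (R : realType) (P : set nat)
  (P_prime : forall p : nat, P p -> prime p) (P_neq0 : P !=set0) :
  exists (x : solenoid R P) N, (1 <= N)%N /\ (3 <= gap_count x N)%N.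
Proof.
(* Here n + 2 = 2 (p + 1) is even, so that h = q (n + 2) / 2 is an integer and
   r = 1 / (n + 2) gives q = 2 r h. *)
have [p Pp] := P_neq0; pose n := p.*2.
have pn : (p <= n.+1)%N by rewrite /n; lia.
have [q [q1 q_small q_gen]] := @exists_modulus R P P_prime n p Pp pn.
have p1 := prime_gt1 (P_prime p Pp).
pose h := (q * p.+1)%N; pose r : R := n.+2%:R^-1; pose e := r / h%:R.
have h4 : (4 <= h)%N by rewrite /h; nia.
have h0 : 0 < h%:R :> R by rewrite ltr0n; lia.
have r0 : 0 < r by rewrite invr_gt0 ltr0n.
have e0 : 0 < e by rewrite divr_gt0.
have ehr : e * h%:R = r by rewrite divfK// gt_eqF.
have n2E : n.+2%:R = 2 * p.+1%:R :> R by rewrite -natrM; congr _%:R; rewrite /n; lia.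
have p0 : p.+1%:R != 0 :> R by rewrite pnatr_eq0.
have qE : q%:R = 2 * r * h%:R.
  by rewrite /r n2E /h natrM; field.
have ren : r + e < n.+1%:R^-1.
  have -> : r + e = h.+1%:R / (n.+2%:R * h%:R).
    by rewrite /e /r -natr1; field; rewrite !gt_eqF// ?ltr0n.
  rewrite -natrM ltr_pdivrMr ?ltr0n ?muln_gt0//=; last lia.
  rewrite mulrC ltr_pdivlMr ?ltr0n// -!natrM ltr_nat /h /n; nia.
pose x : solenoid R P := \pi_(solenoid R P) (real_adele P (2 * r + e)).
have low j c := @le_snorm_real R P P_prime P_neq0 n q q_gen (2 * r + e) j c.
have up j c := @snorm_real_le R P P_prime P_neq0 n q q_small (2 * r + e) j c.
have low2 j : (0 < j <= h)%N -> r <= snorm (x *+ j).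
  move=> jh; apply: low => //; first by apply: ltW; apply: lt_trans ren; lra.
  by move=> m; rewrite qE; have [] := @orbit_gap_bounds R h j r e m h4 jh r0 e0 ehr.
have low1 j : (0 < j <= h.-1)%N -> r + e <= snorm (x *+ j).
  move=> jh; apply: low => //; first exact: ltW.
  move=> m; rewrite qE; have [|_ + _] := @orbit_gap_bounds R h j r e m h4 _ r0 e0 ehr.
    lia.
  by apply; lia.
(* The bound of le_snorm_real caps what is known about the first gap. *)
pose c := Num.min n.+1%:R^-1 (2 * r + e).
have cre : r + e < c by rewrite lt_min ren /=; lra.
have low0 j : (0 < j <= h - 2)%N -> c <= snorm (x *+ j).
  move=> jh; apply: low => //; first by rewrite ge_min lexx.
  move=> m; rewrite qE; have [|_ _ +] := @orbit_gap_bounds R h j r e m h4 _ r0 e0 ehr.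
    lia.
  by move=> le; apply: le_trans (le _); [rewrite ge_min lexx orbT|lia].
have up1 : snorm (x *+ h.-1) <= r + e.
  apply: up; first by rewrite -/r; lra.
  have -> : (2 * r + e) *+ h.-1 - q%:R = - (r + e).
    rewrite qE -mulr_natr -subn1 natrB; last lia.
    rewrite -ehr; ring.
  by rewrite normrN ger0_norm//; lra.
have up2 : snorm (x *+ h) <= r.
  apply: up; first exact: lexx.
  have -> : (2 * r + e) *+ h - q%:R = r.
    rewrite qE -mulr_natr -{3}ehr; ring.
  by rewrite ger0_norm// ltW.
exists x, (h + h - 3)%N; split; first by clear -h4; lia.
apply: (gap_count_ge3 P_prime P_neq0 h4 r0 _ cre low0 low1 low2 up1 up2).
by rewrite ltrDl.
Qed.

Theorem theorem1p1 (R : realType) (P : set nat)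
    (P_prime : forall p : nat, P p -> prime p) (P_neq0 : P !=set0) :
  (forall (alpha : solenoid R P) (N : nat), (1 <= N)%N ->
     (gap_count alpha N <= 3)%N) /\
  (exists (alpha : solenoid R P) (N : nat),
     (1 <= N)%N /\ gap_count alpha N = 3%N).
Proof.
split=> [x N _|]; first exact: gap_count_le3.
have [x [N [N1 gN]]] := @three_gaps_occur R P P_prime P_neq0.
by exists x, N; split=> //; apply/anti_leq; rewrite gap_count_le3.
Qed.
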